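(* Let $G\subset\mathbb{R}^m$ be any set and let $T:\mathbb{R}^m\to\mathbb{R}^m$ be a continuous map. Suppose there exists a map $V:\mathbb{R}^m\to\mathbb{R}$ such that (i) $V$ is continuous at every $x\in\overline{G}$, and (ii) $V(T(x))-V(x)\le 0$ for every $x\in G$. Let $x_0\in G$ and let $\{x(n)\}_{n\in\mathbb{N}}$ be the solution of the initial-value problem $x(n+1)=T(x(n))$, $x(0)=x_0$. If the set $\bigcup_{n=0}^{\infty}\{x(n)\}$ is bounded and $x(n)\in G$ for all $n\in\mathbb{N}$, then there exists $c\in\mathbb{R}$ such that $x(n)\to M\cap V^{-1}(c)$ as $n\to\infty$, where $V^{-1}(c)=\{x\in\mathbb{R}^m \mid V(x)=c\}$ and $M$ is the largest invariant set (of $T$) in $E=\{x\in\overline{G} \mid V(T(x))-V(x)=0\}$.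
   Context: $\mathbb{N}=\{0,1,2,\dots\}$; $\subset$ denotes not necessarily strict inclusion; $\overline{G}$ is the closure of $G$ in $\mathbb{R}^m$. For $x\in\mathbb{R}^m$ and $S\subset\mathbb{R}^m$, $\rho(x,S)=\inf_{y\in S}\|x-y\|$ for some norm on $\mathbb{R}^m$; $x(n)\to S$ means $\lim_{n\to\infty}\rho(x(n),S)=0$. For $H\subset\mathbb{R}^m$, $T(H)=\{T(x)\mid x\in H\}$, and $H$ is invariant if $T(H)=H$. A set $M$ is the largest invariant set in $E\subset\mathbb{R}^m$ if $M\subset E$, $T(M)=M$, and $T(A\cup M)\ne A\cup M$ for every non-empty set $A\subset E$ with $A\cap M=\emptyset$. *)

(* Defs.v *)
From HB Require Import structures.
From mathcomp Require Import all_boot all_order all_algebra.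
From mathcomp Require Import all_classical all_reals all_analysis.
Set Implicit Arguments.
Unset Strict Implicit.
Unset Printing Implicit Defensive.
Import Order.TTheory GRing.Theory Num.Theory.
Import numFieldNormedType.Exports.
Local Open Scope classical_set_scope.
Local Open Scope ring_scope.

(* Nonnegativity and N 0 = 0 follow from the three axioms. *)
Definition is_norm (R : realType) (m : nat) (N : 'rV[R]_m -> R) : Prop :=
  [/\ forall x y, N (x + y) <= N x + N y,
      forall (a : R) x, N (a *: x) = `|a| * N x
    & forall x, N x = 0 -> x = 0].

(* The infimum is taken in the extended reals, so the distance to the empty
   set is +oo and no sequence converges to the empty set. *)
Definition dist_set (R : realType) (m : nat) (N : 'rV[R]_m -> R)
    (S : set 'rV[R]_m) (x : 'rV[R]_m) : \bar R :=
  ereal_inf [set (N (x - y))%:E | y in S].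

Definition cvg_to_set (R : realType) (m : nat) (N : 'rV[R]_m -> R)
    (x : nat -> 'rV[R]_m) (S : set 'rV[R]_m) : Prop :=
  dist_set N S (x n) @[n --> \oo] --> 0%E.

Definition invariant_set (U : Type) (T : U -> U) (H : set U) : Prop :=
  T @` H = H.

Definition largest_invariant_set (U : Type) (T : U -> U) (E M : set U) : Prop :=
  [/\ M `<=` E, invariant_set T M
    & forall A : set U, A !=set0 -> A `<=` E -> A `&` M = set0 ->
        ~ invariant_set T (A `|` M)].

(* Every set has exactly one largest invariant set, so quantifying over all M
   with [largest_invariant_set T E M] is never vacuous. *)
Lemma largest_invariant_set_exists_unique (U : Type) (T : U -> U) (E : set U) :
  exists! M, largest_invariant_set T E M.
Proof.
pose M := [set x | exists2 H : set U, H `<=` E /\ invariant_set T H & H x].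
have ME : M `<=` E by move=> x [H [HE _] /HE].
have MT : invariant_set T M.
  apply/seteqP; split=> [_ [x [H [HE HT] Hx] <-]|x [H [HE HT] Hx]].
    by exists H => //; rewrite -HT; exists x.
  by move: Hx; rewrite -{1}HT => -[y Hy <-]; exists y => //; exists H.
exists M; split.
  split=> // A [a Aa] AE AM AMT.
  have Ma : M a.
    exists (A `|` M); last by left.
    by split=> // x [/AE|/ME].
  by have : (A `&` M) a by []; rewrite AM.
move=> M' [M'E M'T M'max].
have M'M : M' `<=` M by move=> x M'x; exists M'.
apply/seteqP; split=> // x Mx; apply: contrapT => M'x.
apply: (M'max (M `\` M')).
- by exists x.
- by move=> y [/ME].
- by apply/seteqP; split=> // y [[]].
- suff -> : (M `\` M') `|` M' = M by [].
  apply/seteqP; split=> y; first by case=> [[]|/M'M].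
  by move=> My; have [|] := pselect (M' y); [right | left].
Qed.

(* Main.v *)
(* The omega-limit set W, i.e. the set of cluster points of the bounded orbit, is
   contained in the closure of G and satisfies T(W) = W. The values V(x(n))
   decrease and cluster at V(p) for every p in W, so V has a constant value c on
   W; hence W lies in E, and in M by maximality. By compactness the orbit enters
   every neighbourhood of W, and a fortiori approaches M `&` V^-1(c). *)
Require Import Defs.
From HB Require Import structures.
From mathcomp Require Import all_boot all_order all_algebra.
From mathcomp Require Import all_classical all_reals all_analysis.
From mathcomp Require Import lra.
Set Implicit Arguments.
Unset Strict Implicit.
Unset Printing Implicit Defensive.
Import Order.TTheory GRing.Theory Num.Theory.
Import numFieldNormedType.Exports.
Local Open Scope classical_set_scope.
Local Open Scope ring_scope.

(** If [A] were not in [F], the trace of [F] on the complement of [A] would be a proper filter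
    containing [K]. Compactness gives it a cluster point, which also clusters [F], so [A] is a
    neighbourhood of it and must meet its own complement. *)
Lemma compact_cluster_near (U : topologicalType) (F : set_system U)
    (K A : set U) :
  Filter F -> compact K -> F K ->
  (forall p, cluster F p -> nbhs p A) -> F A.
Proof.
move=> FF cK FK clA; apply: contrapT => nFA.
have PF : ProperFilter (within (~` A) F).
  split; last exact: within_filter.
  rewrite /within => F0; apply: nFA.
  by apply: (@filterS _ F) F0 => y /= Ay; apply: contrapT => /Ay.
have [p [_ clp]] : (K `&` cluster (within (~` A) F)) !=set0.
  apply: (cK _ PF); rewrite /within /=.
  by apply: filterS FK => y Ky _.
have pA : nbhs p A.
  apply: clA => B C FB; apply: clp; rewrite /within /=.
  by apply: filterS FB => y By _.
have [q [nAq Aq]] : (~` A) `&` A !=set0.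
  apply: clp pA; rewrite /within /=.
  exact: filterE.
exact: nAq Aq.
Qed.

Lemma cluster_fmap (I : Type) (U W : topologicalType) (F : set_system I)
    (x : I -> U) (f : U -> W) (p : U) :
  {for p, continuous f} -> cluster (x @ F) p -> cluster (f \o x @ F) (f p).
Proof.
move=> fp clp A B FA /fp fB.
have [q [Aq Bq]] := clp (f @^-1` A) (f @^-1` B) FA fB.
by exists (f q).
Qed.

Lemma cluster_cvg_eq (U : topologicalType) (F : set_system U) (p l : U) :
  hausdorff_space U -> F --> l -> cluster F p -> p = l.
Proof. by move=> hU Fl /(cvg_cluster Fl) /hU. Qed.

(** Terms arbitrarily late and close to [c] make [c] a lower bound; one term within [e] of [c] then
    traps all later ones. *)
Lemma nonincreasing_cluster_cvg (R : realType) (u : nat -> R) (c : R) :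
  (forall n, u n.+1 <= u n) -> cluster (u @ \oo) c -> u @ \oo --> c.
Proof.
move=> du clc.
have du' : {homo u : i j / (i <= j)%N >-> j <= i} by apply/nonincreasing_seqP.
have cu n : c <= u n.
  apply/ler_addgt0Pr => e e0.
  have [p np] := (cluster_eventuallyP u c).1 clc e n e0.
  rewrite ler_distlC => /andP[+ _].
  have := du' _ _ np; lra.
apply/cvgrPdist_le => e e0.
have [p _ cp] := (cluster_eventuallyP u c).1 clc e 0%N e0.
exists p => // n /= pn.
rewrite distrC ger0_norm ?subr_ge0//.
move: cp; rewrite distrC ger0_norm ?subr_ge0// => cp.
by apply: le_trans cp; rewrite lerB ?du'.
Qed.

(* A cluster point p of x is the limit of x along a filter finer than \oo;
   along the same filter, the predecessors x (n-1) stay in a compact set, and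
   any of their cluster points is a preimage of p. *)
Lemma invariant_cluster_orbit (U : topologicalType) (T : U -> U) (x : nat -> U)
    (K : set U) :
  hausdorff_space U -> continuous T -> compact K -> (forall n, K (x n)) ->
  (forall n, x n.+1 = T (x n)) -> invariant_set T (cluster (x @ \oo)).
Proof.
move=> hU cT cK xK xT; apply/seteqP; split=> [_ [p clp <-]|p clp].
  (* [T \o x] is the orbit shifted by one, so its cluster points are cluster points of [x]. *)
  have := cluster_fmap (cT p) clp; apply: cvg_cluster => A [n _ nA].
  by exists n => // k /= nk; rewrite -xT; apply: nA; exact: leqW.
(* The finer filter on indices: late times at which the orbit is near [p]. It is proper because [p]
   is a cluster point. *)
pose F := filter_from (fun BN : set U * nat => nbhs p BN.1)
  (fun BN => [set n | (BN.2 <= n)%N /\ BN.1 (x n)]).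
have PF : ProperFilter F.
  apply: filter_from_proper; last first.
    move=> [B n] /= pB.
    have xn : (x @ \oo) (x @` [set k | (n <= k)%N]).
      by exists n => // k /= nk; exists k.
    by have [_ [[k nk <-] Bk]] := clp _ _ xn pB; exists k.
  apply: filter_from_filter; first by exists (setT, 0%N); exact: filterT.
  move=> [B n] [C k] /= pB pC; exists (B `&` C, maxn n k); first exact: filterI.
  by move=> i /= []; rewrite geq_max => /andP[ni ki] [Bi Ci].
have Foo (A : set nat) : \oo A -> F A.
  move=> [n _ nA]; exists (setT, n); first exact: filterT.
  by move=> k /= [/nA].
have xF : x @ F --> p.
  by move=> B pB; exists (B, 0%N) => // k /= [].
have [q [_ clq]] : K `&` cluster (x \o predn @ F) !=set0.
  by apply: cK; apply: (@filterE _ F) => n; exact: xK.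
exists q.
  apply: cvg_cluster clq => A [n _ nA]; apply: Foo.
  (* The rank [n.+1] makes up for the shift by [predn]. *)
  by exists n.+1 => // -[//|k] /= nk; exact: nA.
apply: (@cluster_cvg_eq _ (T \o (x \o predn) @ F)) => //; last first.
  exact: cluster_fmap (cT q) clq.
(* Since [predn 0 = 0], the identity [T (x n.-1) = x n] is only available for positive [n], hence
   the restriction to these indices. *)
apply: cvg_trans xF => A FA; have : F [set n | (0 < n)%N] by apply: Foo; exists 1%N.
by move: FA; apply: (@filterS2 _ F) => -[//|k] /=; rewrite xT.
Qed.

Lemma is_norm0 (R : realType) (m : nat) (N : 'rV[R]_m -> R) :
  is_norm N -> N 0 = 0.
Proof. by move=> [_ NZ _]; rewrite -(scale0r 0) NZ normr0 mul0r. Qed.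

Lemma is_norm_ge0 (R : realType) (m : nat) (N : 'rV[R]_m -> R) :
  is_norm N -> forall y, 0 <= N y.
Proof.
move=> NN y; have [ND NZ _] := NN.
have := ND y (- y); rewrite subrr (is_norm0 NN) -scaleN1r NZ normrN1 mul1r; lra.
Qed.

(** Expand [y] in the canonical basis and bound each coordinate by the max norm. This half of the
    equivalence of norms carries estimates over to [N]. *)
Lemma is_norm_le_normr (R : realType) (m : nat) (N : 'rV[R]_m -> R) :
  is_norm N -> exists2 C : R, 0 < C & forall y, N y <= C * `|y|.
Proof.
move=> NN; have [ND NZ _] := NN.
have [N0 Nge0] := (is_norm0 NN, is_norm_ge0 NN).
(* The summand [1] keeps the constant positive even when [m = 0]. *)
exists (1 + \sum_(i < m) N 'e_i) => [|y].
  by rewrite ltr_wpDr// sumr_ge0.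
apply: (@le_trans _ _ (\sum_(i < m) `|y| * N 'e_i)).
  rewrite {1}(row_sum_delta y).
  have Ns (s : seq 'I_m) :
      N (\sum_(i <- s) y 0 i *: 'e_i) <= \sum_(i <- s) `|y| * N 'e_i.
    elim: s => [|i s ih]; first by rewrite !big_nil N0.
    rewrite !big_cons; apply: le_trans (ND _ _) (lerD _ ih).
    rewrite NZ ler_wpM2r// [leRHS]mx_normrE.
    exact: (le_bigmax _ (fun ij => `|y ij.1 ij.2|) (0, i)).
  exact: Ns.
by rewrite -mulr_sumr mulrC ler_wpM2r// lerDr.
Qed.

Lemma dist_set_lt_cvg (R : realType) (m : nat) (N : 'rV[R]_m -> R)
    (x : nat -> 'rV[R]_m) (S : set 'rV[R]_m) :
  is_norm N ->
  (forall e : R, 0 < e -> \forall n \near \oo, exists2 y, S y & N (x n - y) < e) ->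
  cvg_to_set N x S.
Proof.
move=> /is_norm_ge0 Nge0 xS.
have d0 y : (0 <= dist_set N S y)%E.
  by apply: le_ereal_inf_tmp => _ [z _ <-]; rewrite lee_fin.
have dlt e : 0 < e -> \forall n \near \oo, (dist_set N S (x n) < e%:E)%E.
  move=> /xS; apply: filterS => n [y Sy ye].
  apply: (@le_lt_trans _ _ (N (x n - y))%:E); last by rewrite lte_fin.
  by apply: ereal_inf_lbound; exists y.
have dfin e y : (dist_set N S y < e%:E)%E -> dist_set N S y \is a fin_num.
  by move=> de; rewrite ge0_fin_numE// (lt_trans de)// ltry.
(* Convergence in [\bar R] to a real limit splits into eventual finiteness, given by the bound with
   [e = 1], and convergence of the real parts. *)
apply/fine_cvgP; split.
  by apply: filterS (dlt 1 ltr01) => n; exact: dfin.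
apply/cvgrPdist_lt => e e0; apply: filterS (dlt e e0) => n de /=.
rewrite sub0r normrN ger0_norm ?fine_ge0// -lte_fin fineK//.
exact: dfin de.
Qed.

Theorem theorem1 (R : realType) (m : nat)
    (N : 'rV[R]_m -> R) (N_norm : is_norm N)
    (G : set 'rV[R]_m)
    (T : 'rV[R]_m -> 'rV[R]_m) (T_cont : continuous T)
    (V : 'rV[R]_m -> R)
    (V_cont : forall y, closure G y -> {for y, continuous V})
    (V_decr : forall y, G y -> V (T y) - V y <= 0)
    (x0 : 'rV[R]_m) (Gx0 : G x0)
    (x : nat -> 'rV[R]_m) (x_init : x 0%N = x0)
    (x_rec : forall n, x n.+1 = T (x n))
    (x_bounded : bounded_set (\bigcup_n [set x n]))
    (x_in_G : forall n, G (x n))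
    (M : set 'rV[R]_m)
    (M_largest : largest_invariant_set T
       [set y | closure G y /\ V (T y) - V y = 0] M) :
  exists c : R, cvg_to_set N x (M `&` V @^-1` [set c]).
Proof.
pose W := cluster (x @ \oo).
have [B _ xB] := ex_strict_bound_gt0 x_bounded.
pose K := [set y : 'rV[R]_m | `|y| <= B].
have cK : compact K.
  apply: bounded_closed_compact.
    by exists B; split=> [|r Br y /= /le_trans]; [exact: num_real|apply; exact: ltW].
  have -> : K = (fun y => `|y|) @^-1` [set r | r <= B] by [].
  by apply: closed_comp; [move=> y _; exact: norm_continuous|exact: closed_le].
have xK n : K (x n) by apply/ltW/xB; exists n.
have WT : invariant_set T W.
  exact: (invariant_cluster_orbit (@norm_hausdorff _ _) T_cont cK xK x_rec).
have WG p : W p -> closure G p.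
  by move=> Wp A; apply: Wp; apply: (@filterE _ \oo) => n; exact: x_in_G.
have [p0 [_ Wp0]] : K `&` W !=set0 by apply: cK; apply: (@filterE _ \oo) => n; exact: xK.
have Vc : V \o x @ \oo --> V p0.
  apply: nonincreasing_cluster_cvg => [n|].
    by rewrite /= x_rec -subr_le0; exact: V_decr.
  exact: cluster_fmap (V_cont _ (WG _ Wp0)) Wp0.
have WV p : W p -> V p = V p0.
  move=> Wp; apply: cluster_cvg_eq Vc _; first exact: norm_hausdorff.
  exact: cluster_fmap (V_cont _ (WG _ Wp)) Wp.
have WE p : W p -> closure G p /\ V (T p) - V p = 0.
  move=> Wp; split; first exact: WG.
  (* Both values of [V] equal [V p0], because [T p] lies in [W] by invariance. *)
  rewrite !WV ?subrr// -[X in X _]WT.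
  by exists p.
have WM : W `<=` M.
  case: M_largest => ME MT Mmax p Wp; apply: contrapT => nMp.
  (* Adding this set to [M] gives the union of the invariant sets [W] and [M], which is again
     invariant. *)
  apply: (Mmax (W `\` M)).
  - by exists p.
  - by move=> q [/WE].
  - by apply/seteqP; split=> // q [[]].
  - have -> : (W `\` M) `|` M = W `|` M by rewrite setDE setUIl setUCl setIT.
    by rewrite /invariant_set image_setU WT MT.
exists (V p0); apply: dist_set_lt_cvg => // e e0.
have [C C0 NC] := is_norm_le_normr N_norm.
suff : (x @ \oo) [set z | exists2 y, (M `&` V @^-1` [set V p0]) y & N (z - y) < e].
  by [].
apply: compact_cluster_near cK _ _.
  by apply: (@filterE _ \oo) => n; exact: xK.
(* With [N y <= C * |y|], the max-norm ball of radius [e / C] around [p] lies in the [N]-ball of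
   radius [e]. *)
move=> p Wp; apply/nbhs_ballP; exists (e / C) => /=; first by rewrite divr_gt0.
move=> z; rewrite -ball_normE /= => pz; exists p.
  by split; [exact: WM|exact: WV].
by rewrite (le_lt_trans (NC _))// mulrC -ltr_pdivlMr// distrC.
Qed.
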